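(* There exists a constant $C>0$, independent of $\varepsilon$, such that for every $\varepsilon=1/u_{\max}>0$, $$\sup_{\theta\in\Theta}|F_0(\theta)-F_\varepsilon(\theta)|\le C\,\varepsilon .$$
   Context: **Parameters.** $\theta=(\gamma_1,\kappa,\gamma_2,\omega)$ lies in a known open box $\Theta=(\underline\gamma_1,\overline\gamma_1)\times(\underline\kappa,\overline\kappa)\times(\underline\gamma_2,\overline\gamma_2)\times(\underline\omega,\overline\omega)$ whose closure is a compact subset of $(0,\infty)^4$. **Dynamics.** For a constant control $u\in\mathbb{R}$, the Bloch vector $v=(x,y,z)\in\mathbb{R}^3$ evolves by $\dot v=A_uv+b$ with $$A_u=\begin{pmatrix}-\frac{\gamma_1}{2}-2\gamma_2&-\omega&0\\ \omega&-\frac{\gamma_1}{2}-2\gamma_2&-\kappa u\\0&\kappa u&-\gamma_1\end{pmatrix},\quad b=\begin{pmatrix}0\\0\\\gamma_1\end{pmatrix},\quad \Omega_x=\begin{pmatrix}0&0&0\\0&0&-1\\0&1&0\end{pmatrix}.$$ Let $\phi(v_0;u,t)=e^{A_ut}v_0+\int_0^te^{A_u(t-s)}b\,ds$ be its flow, $v_{\ket{1}}=(0,0,-1)$ the initial state, and $h(v)=\frac12(1-z)$. **Durations.** $t_1>0$ is the unique positive solution of $e^{\overline\gamma_1t_1}(2-\overline\gamma_1t_1)=2$; $\tau_2=(1-\beta)\pi/\overline\kappa$ for a fixed $\beta\in(0,1)$; $t_3=\pi/(\underline\omega+\overline\omega)$. **Observables.** Let $R_t(v)=\phi(v;0,t)$.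 For $\varepsilon=1/u_{\max}>0$ let $P^{\pm}_\varepsilon(v)=\phi(v;\pm1/\varepsilon,\varepsilon\tau_2)$ (a saturated pulse of amplitude $\pm u_{\max}$ and duration $\tau_2/u_{\max}$), and for $\varepsilon=0$ let $P_0^{\pm}(v)=e^{\pm\kappa\tau_2\Omega_x}v$ (the limit as $\varepsilon\to0$). For $\varepsilon\ge0$ set $$F_\varepsilon(\theta)=\Big(h(R_{t_1}(v_{\ket1})),\ h(P_\varepsilon^+(v_{\ket1})),\ h(P_\varepsilon^-\circ R_{t_3}\circ P_\varepsilon^+(v_{\ket1})),\ h(P_\varepsilon^-\circ R_{2t_3}\circ P_\varepsilon^+(v_{\ket1}))\Big).$$ $|\cdot|$ is the Euclidean norm on $\mathbb{R}^4$. *)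

(* Defs.v *)
From HB Require Export structures.
From mathcomp Require Export all_boot all_order all_algebra.
From mathcomp Require Export all_classical all_reals all_analysis.
Set Implicit Arguments.
Unset Strict Implicit.
Unset Printing Implicit Defensive.
Export Order.TTheory GRing.Theory Num.Theory.
Export numFieldNormedType.Exports.
Global Open Scope classical_set_scope.
Global Open Scope ring_scope.

(* A parameter theta is the vector (gamma1, kappa, gamma2, omega). *)
Definition gamma1 (R : realType) (th : 'rV[R]_4) : R := th 0 (inord 0).
Definition kappa (R : realType) (th : 'rV[R]_4) : R := th 0 (inord 1).
Definition gamma2 (R : realType) (th : 'rV[R]_4) : R := th 0 (inord 2).
Definition omega (R : realType) (th : 'rV[R]_4) : R := th 0 (inord 3).

Definition open_box (R : realType) (n : nat) (lo hi : 'rV[R]_n) : set 'rV[R]_n :=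
  [set th | forall i, lo 0 i < th 0 i < hi 0 i].

Definition positive_orthant {R : realType} {n : nat} : set 'rV[R]_n :=
  [set th | forall i, 0 < th 0 i].

Definition euclidean_norm (R : realType) (n : nat) (v : 'rV[R]_n) : R :=
  Num.sqrt (\sum_(i < n) v 0 i ^+ 2).

Definition expmx (R : realType) (n : nat) (A : 'M[R]_n.+1) : 'M[R]_n.+1 :=
  limn (series (fun k : nat => (k`!%:R)^-1 *: A ^+ k)).

Definition mx3 (R : realType) (rows : seq (seq R)) : 'M[R]_3 :=
  \matrix_(i < 3, j < 3) (nth [::] rows i)`_j.

Definition cv3 (R : realType) (x y z : R) : 'cV[R]_3 :=
  \col_(i < 3) [:: x; y; z]`_i.

Definition bloch_mx (R : realType) (th : 'rV[R]_4) (u : R) : 'M[R]_3 :=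
  mx3 [:: [:: - (gamma1 th / 2) - 2 * gamma2 th; - omega th; 0];
          [:: omega th; - (gamma1 th / 2) - 2 * gamma2 th; - (kappa th * u)];
          [:: 0; kappa th * u; - gamma1 th]].

Definition bloch_b (R : realType) (th : 'rV[R]_4) : 'cV[R]_3 :=
  cv3 0 0 (gamma1 th).

Definition Omega_x (R : realType) : 'M[R]_3 :=
  mx3 [:: [:: 0; 0; 0]; [:: 0; 0; -1]; [:: 0; 1; 0]].

(* Meaningful for 0 <= t only: the integral is taken over the set `[0, t]. *)
Definition flow (R : realType) (th : 'rV[R]_4) (v : 'cV[R]_3) (u t : R) :
    'cV[R]_3 :=
  expmx (t *: bloch_mx th u) *m v +
  \col_(i < 3) \int[lebesgue_measure]_(s in `[0, t])
    (expmx ((t - s) *: bloch_mx th u) *m bloch_b th) i 0.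

Definition v_ket1 (R : realType) : 'cV[R]_3 := cv3 0 0 (-1).

Definition h (R : realType) (v : 'cV[R]_3) : R := (1 - v (inord 2) 0) / 2.

Definition tau2 (R : realType) (hi : 'rV[R]_4) (beta : R) : R :=
  (1 - beta) * pi / kappa hi.

Definition t3 (R : realType) (lo hi : 'rV[R]_4) : R :=
  pi / (omega lo + omega hi).

Definition relax (R : realType) (th : 'rV[R]_4) (t : R) (v : 'cV[R]_3) :
    'cV[R]_3 :=
  flow th v 0 t.

(* The pulses P^+ and P^- are the cases sgn = 1 and sgn = -1. *)
Definition pulse (R : realType) (th : 'rV[R]_4) (tau eps sgn : R)
    (v : 'cV[R]_3) : 'cV[R]_3 :=
  if eps == 0 then expmx ((sgn * kappa th * tau) *: Omega_x R) *m v
  else flow th v (sgn / eps) (eps * tau).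

Definition F (R : realType) (t1 tau t3 eps : R) (th : 'rV[R]_4) : 'rV[R]_4 :=
  let v1 := v_ket1 R in
  let Pp := pulse th tau eps 1 in
  let Pm := pulse th tau eps (-1) in
  \row_(i < 4)
    [:: h (relax th t1 v1);
        h (Pp v1);
        h (Pm (relax th t3 (Pp v1)));
        h (Pm (relax th (2 * t3) (Pp v1)))]`_i.

(* Main.v *)
(* A matrix with nonpositive quadratic form generates a semigroup of Euclidean
   contractions, since the derivative of |e^(sA) v|^2 is 2 <y, A y> <= 0. So all
   the flows here are Lipschitz with a constant that does not depend on eps,
   theta or the duration (sqrt 3 in the max norm), and the source term of a pulse
   contributes O(eps).
   The linear part of a pulse is the time-1 exponential of the generator of the
   limit pulse plus eps * tau2 * A_0, so a Gronwall estimate on the difference of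
   the two exponentials gives a gap O(eps), with no smallness of eps needed. The
   two-pulse observables follow by composing these bounds. *)
Require Import Defs.
From mathcomp Require Import ring lra.

Set Implicit Arguments.
Unset Strict Implicit.
Unset Printing Implicit Defensive.

(** * Matrix exponential: entrywise power series and derivative *)

Lemma mx_entry_le_norm (R : realType) (m n : nat) (A : 'M[R]_(m, n)) i j :
  `|A i j| <= `|A|.
Proof.
rewrite [leRHS]/Num.norm/= mx_normrE.
exact: (le_bigmax _ (fun ij => `|A ij.1 ij.2|) (i, j)).
Qed.

Lemma cvg_mx (R : realType) (m n : nat) (M : nat -> 'M[R]_(m, n))
    (L : 'M[R]_(m, n)) :
  (forall i j, (fun k => M k i j) @ \oo --> L i j) -> M @ \oo --> L.
Proof.
move=> ML; apply/cvgrPdist_lt => e e0.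
have H : \forall k \near \oo, forall i j, `|L i j - M k i j| < e.
  apply: filter_forall => i; apply: filter_forall => j.
  by move/cvgrPdist_lt : (ML i j); exact.
apply: filterS H => k H.
rewrite [ltLHS]/Num.norm/= mx_normrE; apply/bigmax_ltP; split => //= -[i j] _.
by rewrite !mxE; exact: H.
Qed.

(** The max norm is not submultiplicative: each product sums [n.+1] terms, hence the extra factor
    per power. The bound is still geometric, so the exponential series dominates. *)
Lemma norm_exprmx_entry_le (R : realType) (n : nat) (A : 'M[R]_n.+1) k i j :
  `|(A ^+ k) i j| <= (n.+1%:R * `|A|) ^+ k.
Proof.
elim: k i j => [|k IH] i j.
  by rewrite !expr0 mxE; case: (_ == _); rewrite ?normr0 ?normr1.
rewrite !exprS -mulmxE mxE (le_trans (ler_norm_sum _ _ _))//.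
have step l : `|A i l * (A ^+ k) l j| <= `|A| * (n.+1%:R * `|A|) ^+ k.
  by rewrite normrM ler_pM ?normr_ge0 ?mx_entry_le_norm ?IH.
apply: (@le_trans _ _ (\sum_(l < n.+1) `|A| * (n.+1%:R * `|A|) ^+ k)).
  apply: ler_sum => l _; exact: step.
by rewrite sumr_const card_ord -[leRHS]mulrA [leRHS]mulr_natl.
Qed.

(** Taylor coefficients in [t] of one entry of [expmx (t *: A)]; they reduce matrix calculus to
    scalar power series. *)
Definition expmx_coef (R : realType) (n : nat) (A : 'M[R]_n.+1) i j : R^nat :=
  fun k => (k`!%:R)^-1 * (A ^+ k) i j.

Lemma is_cvg_pseries_expmx_coef (R : realType) (n : nat) (A : 'M[R]_n.+1) i j t :
  cvgn (pseries (expmx_coef A i j) t).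
Proof.
apply: normed_cvg.
apply: (@series_le_cvg _ _ (exp_coeff (n.+1%:R * `|A| * `|t|))).
- by move=> k; exact: normr_ge0.
- by move=> k; apply: exp_coeff_ge0; rewrite !mulr_ge0.
- move=> k; rewrite /expmx_coef/exp_coeff/= !normrM normrX [(_ * `|t|) ^+ k]exprMn.
  rewrite (ger0_norm (_ : 0 <= k`!%:R^-1)) ?invr_ge0// -mulrA mulrC.
  by rewrite ler_wpM2r ?invr_ge0// ler_wpM2r// norm_exprmx_entry_le.
- exact: is_cvg_series_exp_coeff.
Qed.

Lemma expmxZE (R : realType) (n : nat) (A : 'M[R]_n.+1) t i j :
  expmx (t *: A) i j = limn (pseries (expmx_coef A i j) t).
Proof.
pose L := \matrix_(i, j) limn (pseries (expmx_coef A i j) t).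
suff -> : expmx (t *: A) = L by rewrite mxE.
apply: cvg_lim => //; apply: cvg_mx => p q; rewrite mxE.
rewrite (_ : (fun k => _) = pseries (expmx_coef A p q) t).
  exact: is_cvg_pseries_expmx_coef.
apply/funext => m; rewrite /pseries/series/= summxE; apply: eq_bigr => k _.
by rewrite exprZn !mxE /expmx_coef mulrCA mulrC.
Qed.

(** Coefficient form of (e^(tA))' = A e^(tA): (k+1)/(k+1)! = 1/k! and A^(k+1) = A A^k. *)
Lemma pseries_diffs_expmx_coef (R : realType) (n : nat) (A : 'M[R]_n.+1) i j :
  pseries_diffs (expmx_coef A i j) = \sum_l A i l *: expmx_coef A l j.
Proof.
apply/funext => k; rewrite /pseries_diffs /expmx_coef fct_sumE exprS -mulmxE mxE.
rewrite factS natrM invfM mulrA mulrA mulfV// mul1r mulr_sumr.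
by apply: eq_bigr => l _ /=; rewrite mulrCA.
Qed.

Lemma cvg_pseries_lincomb (R : realType) (m : nat) (a : 'I_m -> R)
    (c : 'I_m -> R^nat) t :
  (forall l, cvgn (pseries (c l) t)) ->
  pseries (\sum_l a l *: c l) t @ \oo --> \sum_l a l * limn (pseries (c l) t).
Proof.
move=> cc.
rewrite (_ : pseries _ t = (fun k => \sum_l a l * pseries (c l) t k)).
  by apply: cvg_big => [|l _]; [exact: add_continuous|apply: cvgMl_tmp; exact: cc].
apply/funext => k; rewrite /pseries/series/=.
under eq_bigr do rewrite fct_sumE mulr_suml.
rewrite exchange_big/=; apply: eq_bigr => l _; rewrite mulr_sumr.
by apply: eq_bigr => p _ /=; rewrite mulrA.
Qed.

Lemma is_derive_expmx (R : realType) (n : nat) (A : 'M[R]_n.+1) (t : R) i j :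
  is_derive t 1 (fun s => expmx (s *: A) i j) ((A *m expmx (t *: A)) i j).
Proof.
have cvg_coef p q s : cvgn (pseries (expmx_coef A p q) s).
  exact: is_cvg_pseries_expmx_coef.
rewrite (_ : (fun s => _) = (fun s => limn (pseries (expmx_coef A i j) s)));
  last by apply/funext => s; rewrite expmxZE.
have d1 s : pseries (pseries_diffs (expmx_coef A i j)) s @ \oo -->
    \sum_l A i l * limn (pseries (expmx_coef A l j) s).
  by rewrite pseries_diffs_expmx_coef; apply: cvg_pseries_lincomb => l.
have dsum : pseries_diffs (pseries_diffs (expmx_coef A i j)) =
    \sum_l A i l *: pseries_diffs (expmx_coef A l j).
  rewrite {1}pseries_diffs_expmx_coef; apply/funext => k.
  rewrite /pseries_diffs !fct_sumE mulr_sumr; apply: eq_bigr => l _ /=.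
  by rewrite mulrCA.
(* Termwise differentiation asks for convergence of the series and of its first two formal
   derivatives at some radius beyond [|t|]; [|t| + 1] is such a radius. Both derived series are
   linear combinations of entry series. *)
apply: is_derive_eq (@pseries_snd_diffs _ _ (`|t| + 1) _ _ _ _ _) _.
- exact: cvg_coef.
- by apply/cvg_ex; eexists; exact: d1.
- rewrite dsum; apply/cvg_ex; eexists; apply: cvg_pseries_lincomb => l.
  rewrite pseries_diffs_expmx_coef; apply/cvg_ex; eexists.
  by apply: cvg_pseries_lincomb => p.
- by rewrite [ltRHS]ger0_norm ?addr_ge0// ltrDl.
- rewrite (cvg_lim _ (d1 t))// mxE.
  by apply: eq_bigr => l _; rewrite expmxZE.
Qed.

Lemma is_derive_expmx_mul (R : realType) (n p : nat) (A : 'M[R]_n.+1)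
    (v : 'M[R]_(n.+1, p)) (t : R) i j :
  is_derive t 1 (fun s => (expmx (s *: A) *m v) i j)
    ((A *m (expmx (t *: A) *m v)) i j).
Proof.
rewrite (_ : (fun s => _) = \sum_l (v l j *: fun s => expmx (s *: A) i l)).
  apply: is_derive_eq.
    apply: is_derive_sum => l; apply: is_deriveZ; exact: is_derive_expmx.
  rewrite mulmxA mxE; apply: eq_bigr => l _.
  by rewrite mulrC.
apply/funext => s; rewrite fct_sumE mxE; apply: eq_bigr => l _.
by rewrite mulrC.
Qed.

Lemma expmx0 (R : realType) (n : nat) : expmx (0 : 'M[R]_n.+1) = 1.
Proof.
apply/matrixP => i j.
rewrite -(scale0r 0) expmxZE (_ : pseries _ _ = series (fun k =>
    ((k == 0%N)%:R * (1%:M : 'M[R]_n.+1) i j))).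
  (* The partial sum of index 0 is empty; the sums are constant only from index 1 on, hence the
     shift. *)
  apply: cvg_lim => //; rewrite -cvg_shiftS.
  rewrite (_ : (fun k => _) = fun=> (1 : 'M[R]_n.+1) i j); first exact: cvg_cst.
  apply/funext => k; rewrite /series/= big_nat_recl//= mul1r.
  by rewrite big1 ?addr0// => l _; rewrite mul0r.
apply/funext => m; apply: eq_bigr => -[|k] _.
  by rewrite /= /expmx_coef !expr0 fact0 invr1 mul1r mulr1.
by rewrite /= expr0n mulr0 mul0r.
Qed.

(** * Energy estimates for dissipative generators *)

Definition dot (R : realType) (n : nat) (v w : 'cV[R]_n) : R :=
  \sum_i v i 0 * w i 0.

Definition sqn (R : realType) (n : nat) (v : 'cV[R]_n) : R := dot v v.

Lemma sqn_ge0 (R : realType) (n : nat) (v : 'cV[R]_n) : 0 <= sqn v.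
Proof. by apply: sumr_ge0 => i _; rewrite -expr2 sqr_ge0. Qed.

Lemma dotDr (R : realType) (n : nat) (u v w : 'cV[R]_n) :
  dot u (v + w) = dot u v + dot u w.
Proof. by rewrite -big_split/=; apply: eq_bigr => i _; rewrite mxE mulrDr. Qed.

Lemma dot_le (R : realType) (n : nat) (v w : 'cV[R]_n) :
  2 * dot v w <= sqn v + sqn w.
Proof.
rewrite mulr_sumr -big_split/=; apply: ler_sum => i _.
by have := sqr_ge0 (v i 0 - w i 0); rewrite expr2; lra.
Qed.

(** The function (|y|^2 + d) e^(-ks) is nonincreasing on [0, 1]. The offset [d] absorbs a bounded
    forcing term; [k = d = 0] gives contraction. Only [0 < t] is asked because [t *: A] inherits
    dissipativity from [A] for nonnegative [t]. *)
Lemma gronwall_sqn (R : realType) (n : nat) (y y' : R -> 'cV[R]_n) (k d : R) :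
  (forall (t : R) i, is_derive t 1 (fun s => y s i 0) (y' t i 0)) ->
  (forall t, 0 < t -> 2 * dot (y t) (y' t) <= k * (sqn (y t) + d)) ->
  sqn (y 1) + d <= expR k * (sqn (y 0) + d).
Proof.
move=> dy yle.
pose g s := (sqn (y s) + d) * expR (- k * s).
have dg (t : R) : is_derive t 1 g
   (expR (- k * t) * (2 * dot (y t) (y' t) - k * (sqn (y t) + d))).
  have ds : is_derive t 1 (fun s => sqn (y s)) (2 * dot (y t) (y' t)).
    rewrite (_ : (fun s => _) = \sum_i ((fun s => y s i 0) ^+ 2)).
      apply: is_derive_eq.
      rewrite mulr_sumr; apply: eq_bigr => i _.
      by rewrite /GRing.scale/=; ring.
    by apply/funext => s; rewrite fct_sumE; apply: eq_bigr => i _.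
  have de : is_derive t 1 (fun s => expR (- k * s)) (- k * expR (- k * t)).
    rewrite (_ : (fun s => _) = expR \o ((- k) *: id)) //.
    by apply: is_derive_eq; rewrite /GRing.scale/= mulr1 mulrC.
  rewrite (_ : g = ((fun s => sqn (y s)) + cst d) * (fun s => expR (- k * s))) //.
  apply: is_derive_eq; rewrite ?fctE /GRing.scale/=.
  ring.
have g10 : g 1 <= g 0.
  apply: (@ler0_derive1_le_cc _ g 0 1) => //.
  - move=> t; rewrite in_itv/= => /andP[t0 _]; rewrite derive1E.
    have [_ ->] := dg t; rewrite pmulr_rle0 ?expR_gt0// subr_le0; exact: yle.
  - apply: continuous_subspaceT => t.
    by apply: differentiable_continuous; apply/derivable1_diffP; have [] := dg t.
  - by rewrite in_itv/= lexx ler01.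
  - by rewrite in_itv/= lexx ler01.
move: g10; rewrite /g mulr0 expR0 mulr1 mulr1 expRN.
by rewrite ler_pdivrMr ?expR_gt0// mulrC.
Qed.

Definition dissipative (R : realType) (n : nat) (A : 'M[R]_n) : Prop :=
  forall v, dot v (A *m v) <= 0.

Lemma sqnZ (R : realType) (n : nat) a (v : 'cV[R]_n) : sqn (a *: v) = a ^+ 2 * sqn v.
Proof. by rewrite /sqn/dot mulr_sumr; apply: eq_bigr => i _; rewrite !mxE; ring. Qed.

Lemma dissipativeZ (R : realType) (n : nat) a (A : 'M[R]_n) :
  0 <= a -> dissipative A -> dissipative (a *: A).
Proof.
move=> a0 dA v; rewrite -scalemxAl (_ : dot _ _ = a * dot v (A *m v)).
  by rewrite mulr_ge0_le0.
by rewrite /dot mulr_sumr; apply: eq_bigr => i _; rewrite !mxE; ring.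
Qed.

Lemma sqn_expmx_le (R : realType) (n : nat) (A : 'M[R]_n.+1) v :
  dissipative A -> sqn (expmx A *m v) <= sqn v.
Proof.
move=> dA; pose y s := expmx (s *: A) *m v.
have := @gronwall_sqn _ _ y (fun s => A *m y s) 0 0.
rewrite /y !addr0 expR0 mul1r scale1r scale0r expmx0 mul1mx; apply.
  by move=> t i; exact: is_derive_expmx_mul.
by move=> t _; rewrite mul0r mulr_ge0_le0.
Qed.

(** The difference y of the two orbits starts at 0 and solves y' = A y + f with f = (A - B) e^(sB)
    v. Dissipativity discards A y, Young's inequality gives 2 <y, f> <= |y|^2 + |f|^2, and
    contraction gives |f|^2 <= d |v|^2. Gronwall then applies with rate 1 and offset d |v|^2. *)
Lemma sqn_expmx_sub_le (R : realType) (n : nat) (A B : 'M[R]_n.+1) d v :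
  dissipative A -> dissipative B -> 0 <= d ->
  (forall w, sqn ((A - B) *m w) <= d * sqn w) ->
  sqn (expmx A *m v - expmx B *m v) <= expR 1 * (d * sqn v).
Proof.
move=> dA dB d0 AB.
pose a s := expmx (s *: A) *m v; pose b s := expmx (s *: B) *m v.
have dd : 0 <= d * sqn v by rewrite mulr_ge0 ?sqn_ge0.
have := @gronwall_sqn _ _ (fun s => a s - b s) (fun s => A *m a s - B *m b s)
  1 (d * sqn v).
rewrite /a /b !scale1r !scale0r subrr (_ : sqn 0 = 0) ?add0r; last first.
  by rewrite -(scale0r (0 : 'cV_n.+1)) sqnZ expr0n mul0r.
move=> H; rewrite (le_trans _ (H _ _)) ?lerDl// {H}.
  move=> t i; rewrite (_ : (fun s => _) =
    (fun s => (expmx (s *: A) *m v) i 0) - (fun s => (expmx (s *: B) *m v) i 0)).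
    have dA' := is_derive_expmx_mul A v t i 0.
    have dB' := is_derive_expmx_mul B v t i 0.
    by apply: is_derive_eq; rewrite [RHS]mxE [X in _ = _ + X]mxE.
  by apply/funext => s; rewrite [LHS]mxE [X in _ + X = _]mxE.
move=> t t0; set x := _ *m v; set w := _ *m v.
have -> : A *m x - B *m w = A *m (x - w) + (A - B) *m w.
  by rewrite mulmxBr mulmxBl addrA subrK.
rewrite dotDr mulrDr mul1r -[leRHS]add0r lerD//; first by rewrite mulr_ge0_le0.
rewrite (le_trans (dot_le _ _))// lerD2l (le_trans (AB w))// ler_wpM2l//.
by rewrite sqn_expmx_le//; apply: dissipativeZ; first exact: ltW.
Qed.

Lemma mx_norm_le (R : realType) (m n : nat) (A : 'M[R]_(m, n)) c :
  0 <= c -> (forall i j, `|A i j| <= c) -> `|A| <= c.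
Proof.
move=> c0 Ac; rewrite [leLHS]/Num.norm/= mx_normrE.
by apply/bigmax_leP; split => // -[i j] _; exact: Ac.
Qed.

Lemma sqn_le_norm (R : realType) (n : nat) (v : 'cV[R]_n) :
  sqn v <= n%:R * `|v| ^+ 2.
Proof.
apply: (@le_trans _ _ (\sum_(i < n) `|v| ^+ 2)).
  apply: ler_sum => i _; rewrite -expr2 -real_normK ?num_real//.
  by rewrite ler_sqr ?nnegrE// mx_entry_le_norm.
by rewrite sumr_const card_ord mulr_natl.
Qed.

Lemma norm_le_sqn (R : realType) (n : nat) (v : 'cV[R]_n) c :
  0 <= c -> sqn v <= c ^+ 2 -> `|v| <= c.
Proof.
move=> c0 vc; apply: mx_norm_le => // i j; rewrite ord1.
rewrite -(ler_sqr (_ : `|v i 0| \is Num.nneg)) ?nnegrE// real_normK ?num_real//.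
apply: le_trans vc; rewrite /sqn/dot (bigD1 i)//= -expr2 lerDl.
by apply: sumr_ge0 => k _; rewrite -expr2 sqr_ge0.
Qed.

(** The square root is the price of passing from the max norm to the Euclidean norm, where the
    contraction holds, and back. *)
Lemma norm_expmx_le (R : realType) (n : nat) (A : 'M[R]_n.+1) (v : 'cV_n.+1) :
  dissipative A -> `|expmx A *m v| <= Num.sqrt n.+1%:R * `|v|.
Proof.
move=> dA; apply: norm_le_sqn; first by rewrite mulr_ge0.
rewrite exprMn sqr_sqrtr// (le_trans (sqn_expmx_le _ dA))//.
exact: sqn_le_norm.
Qed.

Lemma norm_expmx_sub_le (R : realType) (n : nat) (A B : 'M[R]_n.+1) d
    (v : 'cV_n.+1) :
  dissipative A -> dissipative B -> 0 <= d ->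
  (forall w, sqn ((A - B) *m w) <= d ^+ 2 * sqn w) ->
  `|expmx A *m v - expmx B *m v| <= d * Num.sqrt (expR 1 * n.+1%:R) * `|v|.
Proof.
move=> dA dB d0 AB; apply: norm_le_sqn; first by rewrite !mulr_ge0.
rewrite (le_trans (sqn_expmx_sub_le _ dA dB (sqr_ge0 d) AB))//.
rewrite !exprMn sqr_sqrtr ?mulr_ge0 ?expR_ge0//.
rewrite [leRHS](_ : _ = expR 1 * (d ^+ 2 * (n.+1%:R * `|v| ^+ 2))); last by ring.
rewrite ler_wpM2l ?expR_ge0// ler_wpM2l ?sqr_ge0//.
exact: sqn_le_norm.
Qed.

(** * The Bloch generators *)

(** The entries in [omega] and in the control form a skew part that cancels in the quadratic form,
    leaving only damping. Hence no bound degrades as the amplitude [u] grows. *)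
Lemma dissipative_bloch_mx (R : realType) (th : 'rV[R]_4) u :
  0 <= gamma1 th -> 0 <= gamma2 th -> dissipative (bloch_mx th u).
Proof.
move=> g1 g2 v.
rewrite /dot !big_ord_recl big_ord0 !mxE !big_ord_recl !big_ord0 !mxE /=.
set x : R := v _ _; set y : R := v (lift (@ord0 2) (@ord0 1)) _.
set z : R := v (lift _ _) _.
rewrite [leLHS](_ : _ = - ((gamma1 th / 2 + 2 * gamma2 th) * (x ^+ 2 + y ^+ 2) +
  gamma1 th * z ^+ 2)); last by ring.
rewrite oppr_le0; apply: addr_ge0; apply: mulr_ge0 => //; rewrite ?sqr_ge0//.
  lra.
by rewrite addr_ge0 ?sqr_ge0.
Qed.

Lemma dissipative_Omega_x (R : realType) c : dissipative (c *: Omega_x R).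
Proof.
move=> v; rewrite -scalemxAl.
rewrite /dot !big_ord_recl big_ord0 !mxE !big_ord_recl !big_ord0 !mxE /=.
set x : R := v _ _; set y : R := v (lift (@ord0 2) (@ord0 1)) _.
set z : R := v (lift _ _) _.
by rewrite [leLHS](_ : _ = 0) //; ring.
Qed.

Lemma bloch_mxE (R : realType) (th : 'rV[R]_4) u :
  bloch_mx th u = bloch_mx th 0 + (kappa th * u) *: Omega_x R.
Proof.
apply/matrixP => i j; rewrite !mxE.
by case: i => -[|[|[|//]]] ?; case: j => -[|[|[|//]]] ? /=; ring.
Qed.

Lemma sqn_bloch_mx0_le (R : realType) (th : 'rV[R]_4) w :
  0 <= gamma1 th -> 0 <= gamma2 th -> 0 <= omega th ->
  sqn (bloch_mx th 0 *m w) <=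
    (2 * gamma1 th + 2 * gamma2 th + omega th) ^+ 2 * sqn w.
Proof.
move=> g1 g2 om.
rewrite /sqn /dot !big_ord_recl !big_ord0 !mxE !big_ord_recl !big_ord0 !mxE /=.
set x : R := w _ _; set y : R := w (lift (@ord0 2) (@ord0 1)) _.
set z : R := w (lift _ _) _.
set a := gamma1 th in g1 *; set b := gamma2 th in g2 *; set o := omega th in om *.
set K := _ ^+ 2; set c := a / 2 + 2 * b.
(* At zero control the (x, y) block is a scaled rotation and z decouples, so the square splits
   exactly. The constant K dominates both (c + o)^2 and a^2. *)
rewrite [leLHS](_ : _ = (c ^+ 2 + o ^+ 2) * (x ^+ 2 + y ^+ 2) + a ^+ 2 * z ^+ 2);
  last by rewrite /c; ring.
rewrite [leRHS](_ : _ = K * (x ^+ 2 + y ^+ 2) + K * z ^+ 2); last by ring.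
rewrite lerD// ler_wpM2r ?addr_ge0 ?sqr_ge0//; last first.
  by rewrite /K ler_sqr ?nnegrE; lra.
have c0 : 0 <= c by rewrite /c; lra.
apply: (@le_trans _ _ ((c + o) ^+ 2)).
  by have := mulr_ge0 c0 om; rewrite !expr2; lra.
by rewrite /K ler_sqr ?nnegrE /c; lra.
Qed.

Lemma norm_bloch_b_le (R : realType) (th : 'rV[R]_4) :
  0 <= gamma1 th -> `|bloch_b th| <= gamma1 th.
Proof.
move=> g1; apply: mx_norm_le => // i j; rewrite mxE.
by case: i => -[|[|[|//]]] ? /=; rewrite ?normr0 ?ger0_norm.
Qed.

Lemma norm_v_ket1_le (R : realType) : `|v_ket1 R| <= 1.
Proof.
apply: mx_norm_le => // i j; rewrite mxE.
by case: i => -[|[|[|//]]] ? /=; rewrite ?normr0 ?normrN1.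
Qed.

(** * Bounds on the affine flow *)

Lemma continuous_expmx_mul (R : realType) (n p : nat) (A : 'M[R]_n.+1)
    (v : 'M[R]_(n.+1, p)) i j :
  continuous (fun s : R => (expmx (s *: A) *m v) i j).
Proof.
move=> s; apply: differentiable_continuous; apply/derivable1_diffP.
by have [] := is_derive_expmx_mul A v s i j.
Qed.

Lemma norm_forcing_le (R : realType) (th : 'rV[R]_4) (u t : R) :
  0 <= gamma1 th -> 0 <= gamma2 th -> 0 <= t ->
  `|\col_(i < 3) \int[lebesgue_measure]_(s in `[0, t])
    (expmx ((t - s) *: bloch_mx th u) *m bloch_b th) i 0|
  <= Num.sqrt 3%:R * gamma1 th * t.
Proof.
move=> g1 g2 t0; apply: mx_norm_le => [|i j]; first by rewrite !mulr_ge0.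
rewrite mxE.
set f := fun s : R => (expmx ((t - s) *: bloch_mx th u) *m bloch_b th) i 0.
have cf : continuous f.
  move=> s; apply: (@continuous_comp _ _ _ (fun s => t - s)
    (fun r => (expmx (r *: bloch_mx th u) *m bloch_b th) i 0)).
    by apply: continuousB; [exact: cst_continuous|move=> ?; exact: cvg_id].
  exact: continuous_expmx_mul.
have intf (g : R -> R) : continuous g ->
    (@lebesgue_measure R).-integrable `[0, t] (EFin \o g).
  move=> cg; apply: continuous_compact_integrable; first exact: segment_compact.
  exact: continuous_subspaceT.
apply: le_trans (le_normr_Rintegral _ (intf _ cf)) _ => //.
apply: (@le_trans _ _ (\int[lebesgue_measure]_(s in `[0, t])
   (Num.sqrt 3%:R * gamma1 th))).
  apply: le_Rintegral => //.
  - apply: (intf (fun s => `|f s|)) => s.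
    by apply: continuous_comp; [exact: cf|exact: norm_continuous].
  - by apply: intf => s; exact: cst_continuous.
  - move=> s; rewrite /= in_itv/= => /andP[s0 st].
    apply: le_trans (mx_entry_le_norm _ _ _) _.
    apply: le_trans (norm_expmx_le _ _) _.
      apply: dissipativeZ; first by rewrite subr_ge0.
      exact: dissipative_bloch_mx.
    by rewrite ler_wpM2l// norm_bloch_b_le.
(* The length formula distinguishes [0 < t] from the degenerate interval at [t = 0], where it
   returns 0. *)
rewrite Rintegral_cst//= lebesgue_measure_itv/= lte_fin.
by case: ifPn => [_|_] /=; rewrite ?subr0// mulr0 !mulr_ge0.
Qed.

(** The source integrals do not depend on the initial state and cancel, leaving the linear part. *)
Lemma norm_flow_sub_le (R : realType) (th : 'rV[R]_4) (v w : 'cV[R]_3) u t :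
  0 <= gamma1 th -> 0 <= gamma2 th -> 0 <= t ->
  `|flow th v u t - flow th w u t| <= Num.sqrt 3%:R * `|v - w|.
Proof.
move=> g1 g2 t0; rewrite /flow opprD addrACA subrr addr0 -mulmxBr norm_expmx_le//.
by apply: dissipativeZ => //; exact: dissipative_bloch_mx.
Qed.

Lemma norm_flow_le (R : realType) (th : 'rV[R]_4) (v : 'cV[R]_3) u t :
  0 <= gamma1 th -> 0 <= gamma2 th -> 0 <= t ->
  `|flow th v u t| <= Num.sqrt 3%:R * (`|v| + gamma1 th * t).
Proof.
move=> g1 g2 t0; rewrite (le_trans (ler_normD _ _))// mulrDr mulrA.
rewrite lerD ?norm_forcing_le// norm_expmx_le//.
by apply: dissipativeZ => //; exact: dissipative_bloch_mx.
Qed.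

(** * Error of one pulse and of a pulse-relaxation-pulse sequence *)

(** Pulse error per unit of duration [eps * tau], from a state of norm [x]: the first term comes
    from the drift [bloch_mx th 0] in the generator, the second from the source. *)
Definition pulse_gap (R : realType) (g1 g2 om x : R) : R :=
  (2 * g1 + 2 * g2 + om) * Num.sqrt (expR 1 * 3%:R) * x + Num.sqrt 3%:R * g1.

Lemma pulse_gap_ge0 (R : realType) (g1 g2 om x : R) :
  0 <= g1 -> 0 <= g2 -> 0 <= om -> 0 <= x -> 0 <= pulse_gap g1 g2 om x.
Proof. by move=> *; rewrite addr_ge0 ?mulr_ge0 ?addr_ge0 ?mulr_ge0. Qed.

Lemma le_pulse_gap (R : realType) (g1 g2 om x g1' g2' om' x' : R) :
  0 <= g1 <= g1' -> 0 <= g2 <= g2' -> 0 <= om <= om' -> 0 <= x <= x' ->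
  pulse_gap g1 g2 om x <= pulse_gap g1' g2' om' x'.
Proof.
move=> /andP[? ?] /andP[? ?] /andP[? ?] /andP[? ?].
rewrite lerD ?ler_wpM2l// ler_pM// ?ler_wpM2r// ?mulr_ge0//; lra.
Qed.

Lemma norm_pulse_sub_le (R : realType) (th : 'rV[R]_4) (tau eps sgn : R)
    (v : 'cV[R]_3) :
  0 <= gamma1 th -> 0 <= gamma2 th -> 0 <= omega th -> 0 <= tau -> 0 < eps ->
  `|pulse th tau 0 sgn v - pulse th tau eps sgn v| <=
    eps * tau * pulse_gap (gamma1 th) (gamma2 th) (omega th) `|v|.
Proof.
move=> g1 g2 om tau0 eps0; rewrite /pulse eqxx gt_eqF// /flow.
have et0 : 0 <= eps * tau by rewrite mulr_ge0// ltW.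
rewrite opprD addrA (le_trans (ler_normB _ _))// /pulse_gap mulrDr lerD//.
  rewrite !mulrA.
  apply: (@norm_expmx_sub_le _ 2 _ _
    (eps * tau * (2 * gamma1 th + 2 * gamma2 th + omega th))).
  - exact: dissipative_Omega_x.
  - by apply: dissipativeZ => //; exact: dissipative_bloch_mx.
  - by rewrite mulr_ge0// !addr_ge0// mulr_ge0.
  - move=> w; rewrite bloch_mxE scalerDr scalerA.
    (* Duration [eps * tau] times amplitude [sgn / eps] is free of [eps], so the control part is
       exactly the limit generator and only [eps * tau] times the drift remains. *)
    rewrite (_ : eps * tau * _ = sgn * kappa th * tau); last by field; rewrite gt_eqF.
    rewrite opprD addrC subrK mulNmx -scalemxAl -scaleNr sqnZ sqrrN.
    by rewrite [X in _ <= X * _]exprMn -[leRHS]mulrA ler_wpM2l ?sqr_ge0// sqn_bloch_mx0_le.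
by rewrite [leRHS]mulrC norm_forcing_le.
Qed.

(** The intermediate term is the [eps] pulse applied to [v]: one gap compares the two pulses at the
    same state, the other uses the Lipschitz bound. *)
Lemma norm_pulse_sub2_le (R : realType) (th : 'rV[R]_4) (tau eps sgn : R)
    (v w : 'cV[R]_3) :
  0 <= gamma1 th -> 0 <= gamma2 th -> 0 <= omega th -> 0 <= tau -> 0 < eps ->
  `|pulse th tau 0 sgn v - pulse th tau eps sgn w| <=
    eps * tau * pulse_gap (gamma1 th) (gamma2 th) (omega th) `|v| +
    Num.sqrt 3%:R * `|v - w|.
Proof.
move=> g1 g2 om tau0 eps0.
rewrite -(subrKA (pulse th tau eps sgn v)) (le_trans (ler_normD _ _))// lerD//.
  exact: norm_pulse_sub_le.
by rewrite /pulse gt_eqF// norm_flow_sub_le// mulr_ge0// ltW.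
Qed.

Lemma norm_pulse0_le (R : realType) (th : 'rV[R]_4) (tau sgn : R) v :
  `|pulse th tau 0 sgn v| <= Num.sqrt 3%:R * `|v|.
Proof. by rewrite /pulse eqxx; apply/norm_expmx_le/dissipative_Omega_x. Qed.

Lemma norm_h_sub_le (R : realType) (v w : 'cV[R]_3) : `|h v - h w| <= `|v - w|.
Proof.
rewrite /h (_ : _ - _ = - ((v - w) (inord 2) 0) / 2); last by rewrite !mxE; field.
rewrite normrM normrN (le_trans _ (mx_entry_le_norm (v - w) (inord 2) 0))//.
by rewrite ger0_norm// ler_piMr// invf_le1// ler1n.
Qed.

(** The factor 3 is sqrt 3 squared: the error of the first pulse passes through the relaxation and
    the second pulse. The last argument bounds the limit state entering the second pulse, so it is
    free of [eps]. *)
Definition echo_gap (R : realType) (g1 g2 om tau T : R) : R :=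
  tau * (3%:R * pulse_gap g1 g2 om 1 +
    pulse_gap g1 g2 om (Num.sqrt 3%:R * (Num.sqrt 3%:R + g1 * T))).

Lemma norm_echo_sub_le (R : realType) (th : 'rV[R]_4) (g1 g2 om tau eps T : R) :
  0 <= gamma1 th <= g1 -> 0 <= gamma2 th <= g2 -> 0 <= omega th <= om ->
  0 <= tau -> 0 < eps -> 0 <= T ->
  let echo e := pulse th tau e (-1) (relax th T (pulse th tau e 1 (v_ket1 R))) in
  `|echo 0 - echo eps| <= eps * echo_gap g1 g2 om tau T.
Proof.
move=> hg1 hg2 hom tau0 eps0 T0 /=.
have /andP[g1_ge0 _] := hg1; have /andP[g2_ge0 _] := hg2.
have /andP[om_ge0 _] := hom.
have et0 : 0 <= eps * tau by rewrite mulr_ge0// ltW.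
apply: le_trans (norm_pulse_sub2_le _ _ _ g1_ge0 g2_ge0 om_ge0 tau0 eps0) _.
rewrite /echo_gap [leRHS]mulrA [leRHS]mulrDr [leLHS]addrC lerD//.
  rewrite [leRHS](_ : _ = Num.sqrt 3%:R * (Num.sqrt 3%:R *
      (eps * tau * pulse_gap g1 g2 om 1))); last first.
    by rewrite [RHS]mulrA -expr2 sqr_sqrtr// [LHS]mulrCA.
  rewrite ler_wpM2l//.
  apply: le_trans (norm_flow_sub_le _ _ _ g1_ge0 g2_ge0 T0) _.
  rewrite ler_wpM2l//.
  apply: le_trans (norm_pulse_sub_le _ _ g1_ge0 g2_ge0 om_ge0 tau0 eps0) _.
  by rewrite ler_wpM2l// le_pulse_gap// normr_ge0 norm_v_ket1_le.
rewrite ler_wpM2l// le_pulse_gap// normr_ge0/=.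
apply: le_trans (norm_flow_le _ _ g1_ge0 g2_ge0 T0) _.
rewrite ler_wpM2l// lerD ?ler_wpM2r//; last by case/andP: hg1.
rewrite (le_trans (norm_pulse0_le _ _ _ _))// ler_piMr//.
exact: norm_v_ket1_le.
Qed.

(** * Uniform bound over the parameter box *)

Lemma euclidean_norm_le (R : realType) (n : nat) (v : 'rV[R]_n) c :
  0 <= c -> (forall i, `|v 0 i| <= c) -> euclidean_norm v <= Num.sqrt n%:R * c.
Proof.
move=> c0 vc; rewrite -[X in _ * X]ger0_norm// -sqrtr_sqr -sqrtrM//.
rewrite /euclidean_norm ler_wsqrtr//.
apply: (@le_trans _ _ (\sum_(i < n) c ^+ 2)).
  by apply: ler_sum => i _; rewrite -real_normK ?num_real// ler_sqr ?nnegrE.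
by rewrite sumr_const card_ord mulr_natl.
Qed.

Theorem proposition2p6 (R : realType) (lo hi : 'rV[R]_4) (beta t1 : R)
    (lo_lt_hi : forall i, lo 0 i < hi 0 i)
    (compact_closure_Theta : compact (closure (open_box lo hi)))
    (closure_Theta_pos : closure (open_box lo hi) `<=` positive_orthant)
    (beta01 : 0 < beta < 1)
    (t1_unique : unique
       (fun t : R => 0 < t /\ expR (gamma1 hi * t) * (2 - gamma1 hi * t) = 2) t1) :
  exists C : R, 0 < C /\
    forall eps : R, 0 < eps ->
      (ereal_sup
         [set (euclidean_norm
                 (F t1 (tau2 hi beta) (t3 lo hi) 0 th -
                  F t1 (tau2 hi beta) (t3 lo hi) eps th))%:E
         | th in open_box lo hi] <= (C * eps)%:E)%E.
Proof.
have box_pos th i : open_box lo hi th -> 0 < th 0 i.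
  by move=> bth; exact: (closure_Theta_pos _ (subset_closure bth)).
(* Positivity is known for points of the closed box; the midpoint transfers it to the sums
   [lo + hi], hence to [hi] and to the denominators of [tau2] and [t3]. *)
pose mid : 'rV[R]_4 := \row_i ((lo 0 i + hi 0 i) / 2).
have mid_box : open_box lo hi mid.
  by move=> i; rewrite mxE; have := lo_lt_hi i => ?; apply/andP; split; lra.
have lohi_gt0 i : 0 < lo 0 i + hi 0 i.
  by have := box_pos _ i mid_box; rewrite mxE pmulr_lgt0 ?invr_gt0.
have hi_gt0 i : 0 < hi 0 i by have := lo_lt_hi i; have := lohi_gt0 i; lra.
have g1_ge0 : 0 <= gamma1 hi := ltW (hi_gt0 _).
have g2_ge0 : 0 <= gamma2 hi := ltW (hi_gt0 _).
have om_ge0 : 0 <= omega hi := ltW (hi_gt0 _).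
have tau_ge0 : 0 <= tau2 hi beta.
  case/andP: beta01 => _ /ltW b1.
  by rewrite !mulr_ge0 ?subr_ge0 ?pi_ge0 ?invr_ge0 ?(ltW (hi_gt0 _)).
have t3_ge0 : 0 <= t3 lo hi.
  by rewrite mulr_ge0 ?pi_ge0 ?invr_ge0 ?(ltW (lohi_gt0 _)).
have t3'_ge0 : 0 <= 2 * t3 lo hi by rewrite mulr_ge0.
set tau := tau2 hi beta in tau_ge0 *; set T := t3 lo hi in t3_ge0 t3'_ge0 *.
pose gap := pulse_gap (gamma1 hi) (gamma2 hi) (omega hi).
pose eg := echo_gap (gamma1 hi) (gamma2 hi) (omega hi) tau.
have gap_ge0 x : 0 <= x -> 0 <= gap x.
  exact: pulse_gap_ge0.
have eg_ge0 S : 0 <= S -> 0 <= eg S.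
  move=> S0; rewrite mulr_ge0// addr_ge0 ?mulr_ge0 ?gap_ge0//.
  by rewrite mulr_ge0// addr_ge0// mulr_ge0.
(* The summands are nonnegative bounds for the three observables that involve pulses, so [M]
   dominates each of them. *)
pose M := tau * gap 1 + eg T + eg (2 * T).
have M_ge0 : 0 <= M by rewrite !addr_ge0 ?eg_ge0// mulr_ge0 ?gap_ge0.
(* The square root passes from a coordinatewise bound to the Euclidean norm on four coordinates;
   adding 1 makes the constant strictly positive. *)
exists (Num.sqrt 4%:R * M + 1); split; first by rewrite ltr_wpDl// mulr_ge0.
move=> eps eps0; apply: ge_ereal_sup => _ [th bth <-]; rewrite lee_fin.
have th_bd i : 0 <= th 0 i <= hi 0 i.
  by rewrite ltW ?box_pos//=; have /andP[_ /ltW] := bth i.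
apply: (@le_trans _ _ (Num.sqrt 4%:R * (M * eps))); last first.
  by rewrite [leLHS]mulrA ler_wpM2r ?lerDl ?(ltW eps0).
apply: euclidean_norm_le => [|i]; first by rewrite mulr_ge0// ltW.
have echo S : 0 <= S -> eg S <= M -> `|h (pulse th tau 0 (-1)
      (relax th S (pulse th tau 0 1 (v_ket1 R)))) - h (pulse th tau eps (-1)
      (relax th S (pulse th tau eps 1 (v_ket1 R))))| <= M * eps.
  move=> S0 SM; rewrite (le_trans (norm_h_sub_le _ _))//.
  apply: le_trans (norm_echo_sub_le (th_bd _) (th_bd _) (th_bd _) _ _ _) _ => //.
  by rewrite mulrC ler_wpM2r// ltW.
have tg : 0 <= tau * gap 1 by rewrite mulr_ge0 ?gap_ge0.
have eT := eg_ge0 _ t3_ge0; have e2T := eg_ge0 _ t3'_ge0.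
rewrite !mxE; case: i => -[|[|[|[|//]]]] ? /=.
(* The first observable is pure relaxation and does not depend on [eps]. *)
- by rewrite subrr normr0 mulr_ge0// ltW.
- rewrite (le_trans (norm_h_sub_le _ _))//.
  have th_ge0 j : 0 <= th 0 j by case/andP: (th_bd j).
  apply: le_trans (norm_pulse_sub_le _ _ (th_ge0 _) (th_ge0 _) (th_ge0 _) tau_ge0
    eps0) _.
  apply: (@le_trans _ _ (eps * (tau * gap 1))).
    rewrite [leRHS]mulrA ler_wpM2l ?(mulr_ge0 (ltW eps0) tau_ge0)//.
    by apply: le_pulse_gap; rewrite ?normr_ge0 ?norm_v_ket1_le//; exact: th_bd.
  by rewrite mulrC ler_wpM2r ?(ltW eps0)// /M; lra.
- by apply: echo => //; rewrite /M; lra.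
- by apply: echo => //; rewrite /M; lra.
Qed.
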